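(* Let $(f_n)_{n\in\mathbb N}$ be a Boolean function family. Then $(f_n)\in\mathbf{NP}_{\mathrm{IS}}$ if and only if there exist a polynomial $h:\mathbb N\to\mathbb N$ and a Boolean function family $(g_n)_{n\in\mathbb N}\in\mathbf P_{\mathrm{IS}}$ such that for all $n\in\mathbb N$ and all $w\in\mathbb B^n$: $f_n(w)=\mathsf T\iff\exists c\in\mathbb B^*\,\bigl(|c|\le h(n)\wedge g_{|w\diamond c|}(w\diamond c)=\mathsf T\bigr)$.
   Context: Let $\mathbb B=\{\mathsf T,\mathsf F\}$. For $w=(b_1,\dots,b_n)$ and $c=(c_1,\dots,c_m)$ in $\mathbb B^*$, $w\diamond c=(b_1,b_1,\dots,b_n,b_n,\mathsf T,\mathsf F,c_1,\dots,c_m)$. There are Boolean registers named $\mathtt{in}{:}i$, $\mathtt{aux}{:}i$ ($i\ge1$) and $\mathtt{out}$, processing methods $\mathtt{set{:}T}$ (content becomes $\mathsf T$, reply $\mathsf T$), $\mathtt{set{:}F}$ (content becomes $\mathsf F$, reply $\mathsf F$), $\mathtt{get}$ (no change, reply is the content). Basic instructions are $f.m$. Primitive instructions: for each basic instruction $a$, the plain instruction $a$, positive test $+a$, negative test $-a$; forward jumps $\#l$ ($l\in\mathbb N$); termination $!$. An instruction sequence is a finite non-empty sequence $X=u_1;\dots;u_k$ of primitive instructions, $|X|=k$. Execution starts at $u_1$: $a$ executes $a$ and proceeds with the next instruction; $+a$ executes $a$ and proceeds with the next instruction if the reply is $\mathsf T$, otherwise skips the next instruction and proceeds with the one after; $-a$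 likewise with reply roles reversed; $\#l$ proceeds with the $l$-th next instruction ($\#0$ causes inaction); $!$ terminates; if there is no instruction to proceed with, inaction occurs. $\mathcal{IS}_{br}$ is the set of instruction sequences whose basic instructions are all of the forms $\mathtt{in}{:}i.\mathtt{get}$, $\mathtt{aux}{:}i.\mathtt{get}$, $\mathtt{aux}{:}i.\mathtt{set{:}}b$, $\mathtt{out}.\mathtt{set{:}}b$. $X$ computes $f:\mathbb B^n\to\mathbb B$ if for all $b_1,\dots,b_n$, executing $X$ with $\mathtt{in}{:}i$ initially $b_i$ ($i\le n$) and all auxiliary registers and $\mathtt{out}$ initially $\mathsf F$, execution never executes an instruction on $\mathtt{in}{:}i$ with $i>n$, ends by executing $!$, and leaves $f(b_1,\dots,b_n)$ in $\mathtt{out}$. A Boolean function family is a sequence $(f_n)_{n\in\mathbb N}$ with $f_n:\mathbb B^n\to\mathbb B$. $\mathbf P_{\mathrm{IS}}$ is the class of families $(g_n)$ for which there is a polynomial $h$ such that for every $n$ some $X\in\mathcal{IS}_{br}$ computes $g_n$ with $|X|\le h(n)$. $\mathbf{NP}_{\mathrm{IS}}$ is the class of families $(f_n)$ for which there exist a monotonic polynomial $h:\mathbb N\to\mathbb N$ and $(g_n)\in\mathbf P_{\mathrm{IS}}$ such that for all $n$ and $w\in\mathbb B^n$: $f_n(w)=\mathsf T\iff\exists c\in\mathbb B^{h(n)}\,g_{n+h(n)}(wc)=\mathsf T$ ($wc$ is concatenation). *)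

(* Defs.v *)
From HB Require Import structures.
From mathcomp Require Import all_boot all_order all_algebra.

Set Implicit Arguments.
Unset Strict Implicit.
Unset Printing Implicit Defensive.

Inductive reg := RegIn of nat | RegAux of nat | RegOut.

Definition reg_code (r : reg) : nat + nat + unit :=
  match r with
  | RegIn i => inl (inl i)
  | RegAux i => inl (inr i)
  | RegOut => inr tt
  end.

Definition reg_decode (c : nat + nat + unit) : reg :=
  match c with
  | inl (inl i) => RegIn i
  | inl (inr i) => RegAux i
  | inr _ => RegOut
  end.

Lemma reg_codeK : cancel reg_code reg_decode.
Proof. by case. Qed.

HB.instance Definition _ := Equality.copy reg (can_type reg_codeK).

Inductive method := MSet of bool | MGet.

Definition new_content (m : method) (b : bool) : bool :=
  match m with MSet v => v | MGet => b end.

Definition reply (m : method) (b : bool) : bool :=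
  match m with MSet v => v | MGet => b end.

Record basic := Basic { focus : reg; meth : method }.

Inductive instr :=
  | Plain of basic
  | PosTest of basic
  | NegTest of basic
  | Jump of nat
  | Term.

Definition basic_of (u : instr) : option basic :=
  match u with
  | Plain a | PosTest a | NegTest a => Some a
  | Jump _ | Term => None
  end.

(* Register names [in:i] and [aux:i] start at [i = 1]; [RegIn 0] and [RegAux 0]
   are not registers and are excluded here. *)
Definition br_basic (a : basic) : bool :=
  match focus a, meth a with
  | RegIn i, MGet => 0 < i
  | RegAux i, _ => 0 < i
  | RegOut, MSet _ => true
  | _, _ => false
  end.

Definition IS_br (X : seq instr) : bool :=
  (0 < size X) && all (fun u => oapp br_basic true (basic_of u)) X.

Definition state := reg -> bool.

Definition exec_basic (a : basic) (s : state) : state :=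
  fun r => if r == focus a then new_content (meth a) (s r) else s r.

Definition reply_basic (a : basic) (s : state) : bool :=
  reply (meth a) (s (focus a)).

(* A configuration is the 0-based position of the instruction about to be
   executed, together with the register contents. [None] means that there is no
   next configuration: either [!] is executed, or inaction occurs. *)
Definition config : Type := nat * state.

Definition next_config (X : seq instr) (q : config) : option config :=
  let: (k, s) := q in
  match onth X k with
  | Some (Plain a) => Some (k.+1, exec_basic a s)
  | Some (PosTest a) =>
      Some (if reply_basic a s then k.+1 else k.+2, exec_basic a s)
  | Some (NegTest a) =>
      Some (if reply_basic a s then k.+2 else k.+1, exec_basic a s)
  | Some (Jump l) => if l == 0 then None else Some (k + l, s)
  | Some Term => None
  | None => None
  end.

Definition reaches (X : seq instr) (q q' : config) : Prop :=
  exists t, iter t (obind (next_config X)) (Some q) = Some q'.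

(* The contents of the registers [in:i] with [i > size b] are immaterial:
   [computes] forbids executing an instruction on them. *)
Definition initial_state (b : seq bool) : state :=
  fun r => if r is RegIn i then nth false b i.-1 else false.

Definition computes (X : seq instr) (n : nat) (f : n.-tuple bool -> bool) :
    Prop :=
  forall b : n.-tuple bool,
    (forall k s u i m, reaches X (0, initial_state b) (k, s) -> onth X k = Some u ->
       basic_of u = Some (Basic (RegIn i) m) -> i <= n) /\
    (exists k s, reaches X (0, initial_state b) (k, s) /\ onth X k = Some Term /\
       s RegOut = f b).

Definition bool_family := forall n : nat, n.-tuple bool -> bool.

(* Any polynomial function mapping nat to nat: rational coefficients, possibly
   negative, are allowed (real coefficients would give the same functions). *)
Definition polynomial_fun (h : nat -> nat) : Prop :=
  exists p : {poly rat}, forall n, ((h n)%:R = p.[n%:R] :> rat)%R.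

Definition P_IS (g : bool_family) : Prop :=
  exists h : nat -> nat, polynomial_fun h /\
    forall n, exists X : seq instr, IS_br X /\ computes X (@g n) /\ size X <= h n.

Definition NP_IS (f : bool_family) : Prop :=
  exists (h : nat -> nat) (g : bool_family),
    polynomial_fun h /\ {homo h : m n / m <= n} /\ P_IS g /\
    forall (n : nat) (w : n.-tuple bool),
      f n w = true <->
      exists c : (h n).-tuple bool, g (n + h n) (cat_tuple w c) = true.

Definition diamond (w c : seq bool) : seq bool :=
  flatten [seq [:: b; b] | b <- w] ++ [:: true; false] ++ c.

(* Main.v *)
(* Both directions rearrange the input of a given instruction sequence by
   redirecting its reads of input registers.

   From [NP_IS f], with certificates of length [h n]: the map [D n = 2n + 2 + h n]
   is injective, so an input length [D n] determines [n]. On such inputs it is enough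
   to test that positions [2n+1] and [2n+2] contain T and F before running the given
   sequence: if [w <> c] passes and [|c| <= h |w|], then [|w| < n] is excluded by
   monotonicity of [h], and [|w| > n] because the two positions would then hold two
   copies of the same bit of [w].

   Conversely, [h] need not be monotonic; let [H >= h] be a monotonic polynomial.
   A certificate [c] with [k = |c| <= h n] is encoded by [u v] with [|u| = H n + 1]
   and [|v| = H n], where T in [u] at offset [k] selects the length and [v] is
   [c] padded. The program tests the bits of [u] for [k = 0, ..., h n] and runs, at the
   first T, the sequence for length [2n + 2 + k] on [w <> take k v]. *)

Require Import Defs.
From mathcomp Require Import all_boot all_order all_algebra.
From mathcomp Require Import zify.

Set Implicit Arguments.
Unset Strict Implicit.
Unset Printing Implicit Defensive.

Import Order.TTheory GRing.Theory Num.Theory.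

(** * Polynomial functions and their monotone bounds *)

Lemma polynomial_fun_const c : polynomial_fun (fun=> c).
Proof. by exists (c%:R%:P)%R => n; rewrite hornerC. Qed.

Lemma polynomial_fun_id : polynomial_fun id.
Proof. by exists 'X%R => n; rewrite hornerX. Qed.

Lemma polynomial_funD h1 h2 : polynomial_fun h1 -> polynomial_fun h2 ->
  polynomial_fun (fun n => h1 n + h2 n).
Proof.
by move=> [p hp] [q hq]; exists (p + q)%R => n; rewrite hornerD natrD hp hq.
Qed.

Lemma polynomial_funM h1 h2 : polynomial_fun h1 -> polynomial_fun h2 ->
  polynomial_fun (fun n => h1 n * h2 n).
Proof.
by move=> [p hp] [q hq]; exists (p * q)%R => n; rewrite hornerM natrM hp hq.
Qed.

Lemma polynomial_funX h d : polynomial_fun h -> polynomial_fun (fun n => h n ^ d).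
Proof.
by move=> [p hp]; exists (p ^+ d)%R => n; rewrite horner_exp natrX hp.
Qed.

Lemma polynomial_fun_comp h1 h2 : polynomial_fun h1 -> polynomial_fun h2 ->
  polynomial_fun (fun n => h1 (h2 n)).
Proof.
by move=> [p hp] [q hq]; exists (p \Po q)%R => n; rewrite horner_comp hp hq.
Qed.

(** Induction along Horner's scheme: passing from [p] to [p * 'X + a] costs one more factor [n.+1],
    and a natural number above [|a|] absorbs the possibly negative rational [a]. *)
Lemma horner_nat_bound (p : {poly rat}) :
  exists c d, forall n, (p.[n%:R] <= (c * n.+1 ^ d)%:R)%R.
Proof.
elim/poly_ind: p => [|p a [c [d IH]]].
  by exists 0, 0 => n; rewrite horner0 mul0n.
set B := Num.Def.archi_bound `|a|%R.
have ha : (a <= B%:R)%R by apply: le_trans (ler_norm a) (ltW (archi_boundP _)).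
exists (c + B), d.+1 => n; rewrite hornerMXaddC.
apply: (@le_trans _ _ ((c * n.+1 ^ d)%:R * n%:R + B%:R)%R).
  by apply: lerD => //; apply: ler_wpM2r.
rewrite -natrM -natrD ler_nat expnS.
have : 0 < n.+1 ^ d by rewrite expn_gt0.
nia.
Qed.

Lemma polynomial_fun_bound h : polynomial_fun h ->
  exists H, [/\ polynomial_fun H, {homo H : m n / m <= n} & forall n, h n <= H n].
Proof.
move=> [p hp]; have [c [d hb]] := horner_nat_bound p.
exists (fun n => c * n.+1 ^ d); split=> [|m n le_mn|n].
- apply: polynomial_funM; first exact: polynomial_fun_const.
  have [q hq] := polynomial_funD (polynomial_fun_const 1) polynomial_fun_id.
  by apply: polynomial_funX; exists q.
- by rewrite leq_mul2l; case: d {hb} => [|d]; rewrite ?orbT // leq_exp2r ?ltnS // le_mn orbT.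
- by rewrite -(ler_nat rat) hp.
Qed.

(** * Executions as an inductive relation *)

Definition reads_within (N : nat) (u : instr) : bool :=
  if basic_of u is Some (Basic (RegIn i) _) then i <= N else true.

(** Bundles termination, the final value of [out] and the bound on input registers into one
    derivation, so that simulations can proceed by induction on the run. *)
Inductive outputs (N : nat) (X : seq instr) : nat -> state -> bool -> Prop :=
| OutputsTerm k s : onth X k = Some Term -> outputs N X k s (s RegOut)
| OutputsStep k s u k' s' v : onth X k = Some u -> reads_within N u ->
    next_config X (k, s) = Some (k', s') -> outputs N X k' s' v ->
    outputs N X k s v.

Lemma iter_obind_None T (F : T -> option T) t : iter t (obind F) None = None.
Proof. by elim: t => //= t ->. Qed.

Lemma iter_obindS T (F : T -> option T) t x :
  iter t.+1 (obind F) (Some x) = iter t (obind F) (F x).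
Proof. by rewrite iterSr. Qed.

Lemma reaches_step X q q1 q2 :
  next_config X q = Some q1 -> reaches X q1 q2 -> reaches X q q2.
Proof. by move=> e [t ht]; exists t.+1; rewrite iter_obindS e. Qed.

Lemma reaches_inv X q q' : reaches X q q' ->
  q = q' \/ exists2 q1, next_config X q = Some q1 & reaches X q1 q'.
Proof.
case=> -[[->]|t]; first by left.
rewrite iter_obindS.
case: (next_config X q) => [q1 ht|]; last by rewrite iter_obind_None.
by right; exists q1 => //; exists t.
Qed.

(** Execution is deterministic, so every reachable configuration lies on the single run that the
    derivation records. *)
Lemma outputs_reads N X k s v k' s' u : outputs N X k s v ->
  reaches X (k, s) (k', s') -> onth X k' = Some u -> reads_within N u.
Proof.
move=> H; elim: H k' s' u => {k s v} [k s e|k s u0 k1 s1 v e hu en _ IH] k' s' u.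
  case/reaches_inv=> [[<- _]|[q]]; first by rewrite e => -[<-].
  by rewrite /= e.
case/reaches_inv=> [[<- _]|[q]]; first by rewrite e => -[<-].
by rewrite en => -[<-]; apply: IH.
Qed.

Lemma outputs_halts N X k s v : outputs N X k s v ->
  exists k' s', reaches X (k, s) (k', s') /\ onth X k' = Some Term /\ s' RegOut = v.
Proof.
elim=> {k s v} [k s e|k s u k1 s1 v _ _ en _ [k' [s' [hr he]]]].
  by exists k, s; split=> //; exists 0.
by exists k', s'; split=> //; apply: reaches_step en hr.
Qed.

Lemma halts_outputs N X k s k' s' :
    (forall k1 s1 u, reaches X (k, s) (k1, s1) -> onth X k1 = Some u ->
       reads_within N u) ->
    reaches X (k, s) (k', s') -> onth X k' = Some Term ->
  outputs N X k s (s' RegOut).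
Proof.
move=> + [t]; elim: t k s => [|t IH] k s hs; first by case=> <- <-; exact: OutputsTerm.
rewrite iter_obindS.
case en: (next_config X (k, s)) => [[k1 s1]|]; last by rewrite iter_obind_None.
move=> ht et; case eu: (onth X k) => [u|]; last by move: en; rewrite /= eu.
apply: (OutputsStep eu _ en); first by apply: hs eu; exists 0.
by apply: IH => // k2 s2 u2 hr; apply: hs; apply: reaches_step en hr.
Qed.

Lemma computesP X n (f : n.-tuple bool -> bool) :
  computes X f <-> forall b : n.-tuple bool, outputs n X 0 (initial_state b) (f b).
Proof.
split=> H b.
  have [hs [k [s [hr [he <-]]]]] := H b.
  apply: halts_outputs hr he => k1 s1 u hr1 hu.
  rewrite /reads_within; case eb: (basic_of u) => [[[i|i|] m]|] //.
  exact: hs hr1 hu eb.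
split; last exact: outputs_halts (H b).
move=> k s u i m hr hu eb; have := outputs_reads (H b) hr hu.
by rewrite /reads_within eb.
Qed.

(** * Redirecting the reads of an instruction sequence *)

(* A source [inl j] stands for the input register [in:j+1], and a source [inr v]
   for the constant [v]. Reading a constant is simulated by [aux:1.set:v], whose
   reply is [v]; [aux:1] is made available by shifting the auxiliary registers. *)
Definition source := (nat + bool)%type.

Definition source_val (z : seq bool) (r : source) : bool :=
  match r with inl j => nth false z j | inr v => v end.

Definition redirect_basic (rho : nat -> source) (a : basic) : basic :=
  match focus a with
  | RegIn i => match rho i.-1 with
               | inl j => Basic (RegIn j.+1) MGet
               | inr v => Basic (RegAux 1) (MSet v)
               end
  | RegAux i => Basic (RegAux i.+1) (meth a)
  | RegOut => a
  end.

Definition redirect (rho : nat -> source) (u : instr) : instr :=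
  match u with
  | Plain a => Plain (redirect_basic rho a)
  | PosTest a => PosTest (redirect_basic rho a)
  | NegTest a => NegTest (redirect_basic rho a)
  | Jump l => Jump l
  | Term => Term
  end.

Definition br_instr (u : instr) : bool := oapp br_basic true (basic_of u).

Lemma br_redirect rho X : all br_instr X -> all br_instr (map (redirect rho) X).
Proof.
move=> hX; rewrite all_map; apply: sub_all hX.
have hb a : br_basic a -> br_basic (redirect_basic rho a).
  by case: a => -[i|i|] m //=; rewrite /redirect_basic /=; case: (rho _).
by case=> //= a; apply: hb.
Qed.

Definition simulates (m : nat) (rho : nat -> source) (s s' : state) : Prop :=
  [/\ forall i, i < m ->
        s (RegIn i.+1) = match rho i with inl j => s' (RegIn j.+1) | inr v => v end,
      forall i, 0 < i -> s (RegAux i) = s' (RegAux i.+1)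
    & s RegOut = s' RegOut].

Lemma exec_get r s : exec_basic (Basic r MGet) s =1 s.
Proof. by move=> r'; rewrite /exec_basic /= if_same. Qed.

Lemma simulates_ext m rho s s' s1 s1' :
  s1 =1 s -> s1' =1 s' -> simulates m rho s s' -> simulates m rho s1 s1'.
Proof.
move=> e e' [h1 h2 h3]; split=> [i hi|i hi|]; rewrite e ?h1 ?h2 ?h3 ?e' //.
by case: (rho i) => // j; rewrite e'.
Qed.

Lemma simulates_basic m rho s s' a : br_basic a ->
    (if focus a is RegIn i then i <= m else true) -> simulates m rho s s' ->
  reply_basic a s = reply_basic (redirect_basic rho a) s' /\
  simulates m rho (exec_basic a s) (exec_basic (redirect_basic rho a) s').
Proof.
case: a => -[[|i]|i|] [v|] //= hbr hi hs; have [h1 h2 h3] := hs;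
  rewrite /redirect_basic /reply_basic /=.
- rewrite (h1 i hi); case: (rho i) => [j|v] /=; split=> //.
    exact: simulates_ext (exec_get _ _) (exec_get _ _) hs.
  apply: simulates_ext (exec_get _ _) (frefl _) _.
  split=> // i0 i0_gt0; rewrite h2 // /exec_basic /=.
  (* Writing the constant to [aux:1] is invisible: the simulated [aux:i0] lives in [aux:(i0+1)], and
     [i0 > 0]. *)
  by case: eqP => // -[]; lia.
- split=> //; split=> // i0 i0_gt0; rewrite /exec_basic /=.
  have -> : (RegAux i0.+1 == RegAux i.+1) = (RegAux i0 == RegAux i).
    by apply/eqP/eqP => [[->]|[->]].
  by rewrite h2.
- by split; [exact: h2|exact: simulates_ext (exec_get _ _) (exec_get _ _) hs].
- by split.
Qed.

Lemma simulates_init m rho z s' : s' =1 initial_state z ->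
  simulates m rho (initial_state (mkseq (fun i => source_val z (rho i)) m)) s'.
Proof.
move=> hs; split=> [i hi|i _|]; rewrite ?hs //=.
by rewrite nth_mkseq //; case: (rho i) => //= j; rewrite hs.
Qed.

(** Redirection is instruction by instruction and jumps are relative, so the copy runs in lockstep
    with [X], displaced by [size P]. The run ends at a [!] inside [X], hence never enters [Q]. *)
Lemma outputs_redirect m N rho X P Q k s v s' :
    all br_instr X -> (forall i j, i < m -> rho i = inl j -> j < N) ->
    outputs m X k s v -> simulates m rho s s' ->
  outputs N (P ++ map (redirect rho) X ++ Q) (size P + k) s' v.
Proof.
move=> hX hrho H; elim: H s' => {k s v} [k s e|k s u k1 s1 v e hu en _ IH] s' hs.
  have [_ _ ->] := hs; apply: OutputsTerm.
  by rewrite onth_cat ltnNge leq_addr addKn onth_cat size_map -onthTE e onth_map e.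
have e' : onth (P ++ map (redirect rho) X ++ Q) (size P + k) = Some (redirect rho u).
  by rewrite onth_cat ltnNge leq_addr addKn onth_cat size_map -onthTE e onth_map e.
have hbr : br_instr u.
  have hk : k < size X by rewrite -onthTE e.
  by rewrite -(onth_nth Term _ _ _ e); apply: (all_nthP _ hX).
have hN : reads_within N (redirect rho u).
  have hb a : br_basic a -> reads_within m (Plain a) ->
      reads_within N (Plain (redirect_basic rho a)).
    case: a => -[[|i]|i|] [w|] //= _; rewrite /redirect_basic /reads_within /= => hi.
    by case E: (rho i) => [j|] //=; apply: hrho E.
  by case: u {e e' en} hbr hu => //= a; apply: hb.
have hsim a : basic_of u = Some a ->
    reply_basic a s = reply_basic (redirect_basic rho a) s' /\
    simulates m rho (exec_basic a s) (exec_basic (redirect_basic rho a) s').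
  move=> ea; apply: simulates_basic hs; first by move: hbr; rewrite /br_instr ea.
  by move: hu; rewrite /reads_within ea; case: (a) => -[].
move: en; rewrite /= e.
case: u {e} e' hbr hN hu hsim => [a|a|a|l|] //= e' _ hN _ hsim.
- case=> ? ?; subst k1 s1; have [_ hs'] := hsim a erefl.
  by apply: (OutputsStep e' hN); [rewrite /= e'; reflexivity|rewrite -addnS; exact: IH].
- case=> ? ?; subst k1 s1; have [hr hs'] := hsim a erefl.
  apply: (OutputsStep e' hN); [rewrite /= e'; reflexivity|rewrite -hr].
  by move: (IH _ hs'); case: ifP => _; rewrite ?addnS.
- case=> ? ?; subst k1 s1; have [hr hs'] := hsim a erefl.
  apply: (OutputsStep e' hN); [rewrite /= e'; reflexivity|rewrite -hr].
  by move: (IH _ hs'); case: ifP => _; rewrite ?addnS.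
- case: ifP => // hl [? ?]; subst k1 s1.
  apply: (OutputsStep e' hN); first by rewrite /= e' hl.
  by rewrite -addnA; exact: IH.
Qed.

(** * Programs that branch on input bits *)

(** Reply T to the negative test skips the jump and enters the copy of [Y k]; reply F takes the jump
    over that copy to the next test. The final [!] is reached with [out] still F. *)
Definition branches (j : nat -> nat) (rho : nat -> nat -> source)
    (Y : nat -> seq instr) (ks : seq nat) : seq instr :=
  foldr (fun k P => [:: NegTest (Basic (RegIn (j k).+1) MGet); Jump (size (Y k)).+1]
                    ++ map (redirect (rho k)) (Y k) ++ P) [:: Term] ks.

Definition first_branch (j : nat -> nat) (z : seq bool) (V : nat -> bool)
    (ks : seq nat) : bool :=
  foldr (fun k r => if nth false z (j k) then V k else r) false ks.

(** The prefix [P] is general so that a branch passed over can be absorbed into it. States are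
    compared pointwise because executing a [get] rebuilds the state function. *)
Lemma outputs_branches N j rho Y m V ks z P s :
    {in ks, forall k, [/\ j k < N, all br_instr (Y k),
       forall i l, i < m k -> rho k i = inl l -> l < N
     & outputs (m k) (Y k) 0
         (initial_state (mkseq (fun i => source_val z (rho k i)) (m k))) (V k)]} ->
    s =1 initial_state z ->
  outputs N (P ++ branches j rho Y ks) (size P) s (first_branch j z V ks).
Proof.
elim: ks P s => [|k ks IH] P s hks hs /=.
  rewrite -[false](hs RegOut); apply: OutputsTerm.
  by rewrite onth_cat ltnn subnn.
have [hj hY hrho hV] := hks k (mem_head _ _).
set t := Basic _ MGet.
have hon i : onth (P ++ NegTest t :: Jump (size (Y k)).+1
      :: map (redirect (rho k)) (Y k) ++ branches j rho Y ks) (size P + i) =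
    onth (NegTest t :: Jump (size (Y k)).+1
      :: map (redirect (rho k)) (Y k) ++ branches j rho Y ks) i.
  by rewrite onth_cat ltnNge leq_addr addKn.
have h0 := hon 0; rewrite addn0 in h0.
have hr : reply_basic t s = nth false z (j k) by rewrite /reply_basic /= hs.
apply: (OutputsStep h0 hj); first by rewrite /= h0 /= hr.
have hs' : exec_basic t s =1 initial_state z by move=> r; rewrite exec_get hs.
case: ifP => _.
  rewrite -cat_rcons -cat_rcons.
  rewrite -[X in outputs _ _ X _ _]addn0.
  have -> : (size P).+2 = size (rcons (rcons P (NegTest t)) (Jump (size (Y k)).+1)).
    by rewrite !size_rcons.
  exact: outputs_redirect hY hrho hV (simulates_init _ _ hs').
have h1 := hon 1; rewrite addn1 in h1.
apply: (OutputsStep h1) => //; first by rewrite /next_config h1.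
rewrite -cat_rcons -cat_rcons catA.
have -> : (size P).+1 + (size (Y k)).+1 = size (rcons (rcons P (NegTest t))
    (Jump (size (Y k)).+1) ++ map (redirect (rho k)) (Y k)).
  by rewrite size_cat !size_rcons size_map addnS.
by apply: IH => // k' hk'; apply: hks; rewrite inE hk' orbT.
Qed.

Lemma br_branches j rho Y ks : {in ks, forall k, all br_instr (Y k)} ->
  all br_instr (branches j rho Y ks).
Proof.
elim: ks => //= k ks IH hY; rewrite all_cat br_redirect ?hY ?mem_head //=.
by apply: IH => k' hk'; apply: hY; rewrite inE hk' orbT.
Qed.

Lemma size_branches j rho Y ks M : {in ks, forall k, size (Y k) <= M} ->
  size (branches j rho Y ks) <= size ks * M.+2 + 1.
Proof.
elim: ks => //= k ks IH hY; rewrite size_cat size_map.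
have : size (Y k) <= M by apply: hY; rewrite mem_head.
have : size (branches j rho Y ks) <= size ks * M.+2 + 1.
  by apply: IH => k' hk'; apply: hY; rewrite inE hk' orbT.
lia.
Qed.

(** Makes malformed selectors harmless: whichever branch is taken, acceptance still exhibits some
    accepting [k]. *)
Lemma first_branch_has j z V ks : first_branch j z V ks -> has V ks.
Proof.
by elim: ks => //= k ks IH; case: ifP => _; [move=> ->|move/IH->; rewrite orbT].
Qed.

Lemma first_branch_single j z V ks k : k \in ks ->
    {in ks, forall k', nth false z (j k') = (k' == k)} ->
  first_branch j z V ks = V k.
Proof.
elim: ks => //= k' ks IH hk hz.
rewrite hz ?mem_head //; case: eqP => [->//|/eqP ne].
apply: IH => [|k'' hk'']; last by apply: hz; rewrite inE hk'' orbT.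
by move: hk; rewrite inE eq_sym (negbTE ne).
Qed.

(** * Families assembled from prescribed input lengths *)

(** Application to a bare list avoids transport between tuple types of equal length. *)
Definition family_at (g : bool_family) (z : seq bool) : bool :=
  g (size z) (in_tuple z).

Lemma family_atE (g : bool_family) n (t : n.-tuple bool) : g n t = family_at g t.
Proof.
case: t => z hz; rewrite /family_at /=; have e := eqP hz; subst n.
by congr (g _ _); apply: val_inj.
Qed.

(** Choosing below a bound needs no choice axiom, and each program built later uses sequences for
    finitely many lengths only. *)
Lemma finite_choice T (P : nat -> T -> Prop) (x0 : T) M :
  (forall n, exists x, P n x) -> exists F, forall n, n < M -> P n (F n).
Proof.
move=> hP; elim: M => [|M [F hF]]; first by exists (fun=> x0).
have [x hx] := hP M; exists (fun n => if n == M then x else F n) => n.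
by rewrite ltnS leq_eqVlt; case: eqP => [->|_ /hF].
Qed.

Lemma P_IS_outputs (g : bool_family) : P_IS g ->
  exists h, [/\ polynomial_fun h, {homo h : m n / m <= n} & forall M,
    exists X : nat -> seq instr, forall n, n < M ->
      [/\ all br_instr (X n), size (X n) <= h n & forall z, size z = n ->
        outputs n (X n) 0 (initial_state z) (family_at g z)]].
Proof.
move=> [h0 [/polynomial_fun_bound [h [hp hm hh]] hX]].
exists h; split=> // M; have [X hX'] := finite_choice [::] M hX.
exists X => n /hX' [/andP[_ hbr] [/computesP hc hs]]; split=> // [|z hz].
  exact: leq_trans (hh n).
by subst n; exact: hc (in_tuple z).
Qed.

(** Decodes [n] from the input length by a bounded search, complete once [n <= D n]; lengths outside
    the range of [D] give F. *)
Definition glue (D : nat -> nat) (B : nat -> seq bool -> bool) : bool_family :=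
  fun N z => has (fun n => (D n == N) && B n z) (iota 0 N.+1).

Lemma glueE D B n z : injective D -> n <= D n -> size z = D n ->
  family_at (glue D B) z = B n z.
Proof.
move=> hD hn hz; apply/hasP/idP => [[n' _ /andP[/eqP e]]|hB].
  by have /hD -> : D n' = D n by rewrite e.
exists n; last by rewrite /= hz eqxx.
by rewrite mem_iota hz /= add0n ltnS.
Qed.

Lemma P_IS_glue D B p : polynomial_fun p -> injective D -> (forall n, n <= D n) ->
    (forall n, exists X, [/\ IS_br X, size X <= p (D n) &
       forall z, size z = D n -> outputs (D n) X 0 (initial_state z) (B n z)]) ->
  P_IS (glue D B).
Proof.
move=> hp hD hDn hX; exists (fun N => p N + 1); split.
  by apply: polynomial_funD hp (polynomial_fun_const 1).
move=> N; case: (boolP (has (fun n => D n == N) (iota 0 N.+1))) => [|hN].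
  case/hasP=> n _ /eqP <-; have [X [hbr hs ho]] := hX n.
  exists X; split=> //; split; last exact: leq_trans (leq_addr _ _).
  apply/computesP => b; rewrite family_atE (@glueE _ _ n) ?size_tuple //.
  by apply: ho; rewrite size_tuple.
(* No [n] has this input length: a lone [!] leaves [out] at F, and the summand 1 in the bound pays
   for it. *)
exists [:: Term]; split=> //; split; last by rewrite addn1.
apply/computesP => b; suff -> : glue D B b = false by exact: OutputsTerm.
apply/negbTE/hasPn => n hn; rewrite negb_and.
by have /hasPn/(_ n hn) -> := hN.
Qed.

(** * Index maps between the two input layouts *)

Lemma size_diamond w c : size (diamond w c) = (size w).*2 + (size c).+2.
Proof. by rewrite size_cat; congr (_ + _); elim: w => //= b w ->. Qed.

Lemma nth_diamond w c i : nth false (diamond w c) i =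
  if i < (size w).*2 then nth false w i./2
  else nth false [:: true, false & c] (i - (size w).*2).
Proof.
rewrite /diamond; elim: w i => [|b w IH] i; first by rewrite subn0.
by case: i => [|[|i]] //=; rewrite IH.
Qed.

(* On [w <> c] with [|w| = n], [demux_source n] recovers the concatenation [wc]. *)
Definition demux_source (n i : nat) : source :=
  if i < n then inl i.*2 else inl (i + n.+2).

Lemma demuxE n h w c : size w = n -> size c = h ->
  mkseq (fun i => source_val (diamond w c) (demux_source n i)) (n + h) = w ++ c.
Proof.
move=> hw hc; apply: (@eq_from_nth _ false) => [|i].
  by rewrite size_mkseq size_cat hw hc.
rewrite size_mkseq => hi; rewrite nth_mkseq // nth_cat hw /demux_source.
case: ltnP => h1 /=; rewrite nth_diamond hw.
  by rewrite ltn_double h1 doubleK.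
rewrite ifF; last lia.
by have -> : i + n.+2 - n.*2 = (i - n).+2 by lia.
Qed.

(* Recovers [w <> c] from [w u v], where [|w| = n], [|u| = l] and [c] is a prefix
   of [v]. *)
Definition mux_source (n l i : nat) : source :=
  if i < n.*2 then inl i./2
  else if i == n.*2 then inr true
  else if i == n.*2.+1 then inr false
  else inl (i - n.*2.+2 + (n + l)).

Lemma muxE n l k w u v : size w = n -> size u = l -> k <= size v ->
  mkseq (fun i => source_val (w ++ u ++ v) (mux_source n l i)) (n.*2 + k.+2)
  = diamond w (take k v).
Proof.
move=> hw hu hk; apply: (@eq_from_nth _ false) => [|i].
  by rewrite size_mkseq size_diamond hw size_takel.
rewrite size_mkseq => hi; rewrite nth_mkseq // nth_diamond hw /mux_source.
case: ltnP => h1 /=; first by rewrite nth_cat hw ifT //; lia.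
case: eqP => [->|h2] /=; first by rewrite subnn.
case: eqP => [->|h3] /=; first by rewrite subSn // subnn.
rewrite catA nth_cat size_cat hw hu ifF; last lia.
have -> : i - n.*2 = (i - n.*2.+2).+2 by lia.
by rewrite /= nth_take; [congr nth; lia|lia].
Qed.

(** * The two inclusions *)

Definition sat_by_diamond (h : nat -> nat) (g f : bool_family) : Prop :=
  forall (n : nat) (w : n.-tuple bool),
    f n w = true <->
    exists c : seq bool, size c <= h n /\ family_at g (diamond w c) = true.

Lemma NP_IS_diamond f : NP_IS f ->
  exists h g, [/\ polynomial_fun h, P_IS g & sat_by_diamond h g f].
Proof.
move=> [h [g [hp [hm [hg hf]]]]].
pose D n := n.*2 + (h n).+2.
have hD : injective D.
  move=> m n; rewrite /D; case: (ltngtP m n) => // lt_mn; have := hm _ _ (ltnW lt_mn); lia.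
have hDn n : n <= D n by rewrite /D; lia.
pose B n z := [&& nth false z n.*2, ~~ nth false z n.*2.+1
  & family_at g (mkseq (fun i => source_val z (demux_source n i)) (n + h n))].
exists h, (glue D B); split=> // [|n w].
  have [H [Hp Hm HX]] := P_IS_outputs hg.
  apply: (@P_IS_glue _ _ (fun N => 4 + H N)) => // [|n].
    exact: polynomial_funD (polynomial_fun_const 4) Hp.
  have [Y hY] := HX (n + h n).+1; have [] := hY _ (ltnSn _).
  move: (Y _) => X hbr hs ho.
  (* Each [!] here is skipped exactly when its marker bit is right; otherwise it halts with [out] at
     F. These four instructions account for the 4 in the size bound. *)
  pose P := [:: NegTest (Basic (RegIn n.*2.+1) MGet); Term;
                PosTest (Basic (RegIn n.*2.+2) MGet); Term].
  exists (P ++ map (redirect (demux_source n)) X); split.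
  - by rewrite /IS_br /=; exact: br_redirect.
  - by rewrite /= size_map !ltnS (leq_trans hs) // Hm // /D; lia.
  move=> z hz.
  have outputs_false k s : onth (P ++ map (redirect (demux_source n)) X) k = Some Term ->
      s =1 initial_state z ->
      outputs (D n) (P ++ map (redirect (demux_source n)) X) k s false.
    by move=> e hs'; rewrite -[false](hs' RegOut); apply: OutputsTerm.
  apply: (@OutputsStep _ _ _ _ (NegTest (Basic (RegIn n.*2.+1) MGet))) => //.
    by rewrite /reads_within /= /D; lia.
  rewrite /reply_basic /= /B; case: (nth false z n.*2); last first.
    by apply: outputs_false => //; exact: exec_get.
  apply: (@OutputsStep _ _ _ _ (PosTest (Basic (RegIn n.*2.+2) MGet))) => //.
    by rewrite /reads_within /= /D; lia.
  set s2 := exec_basic _ (exec_basic _ _).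
  have hs2 : s2 =1 initial_state z by move=> r; rewrite /s2 !exec_get.
  rewrite /reply_basic /= exec_get /=.
  case: (nth false z n.*2.+1) => /=; first exact: outputs_false.
  rewrite -[map _ _]cats0 -[4]addn0.
  apply: (@outputs_redirect (n + h n) _ _ _ P) hbr _ (ho _ _) (simulates_init _ _ hs2).
    by move=> i j hi; rewrite /demux_source /D; case: ltnP => hin [<-]; lia.
  by rewrite size_mkseq.
have hBc (c : seq bool) : size c = h n ->
    family_at (glue D B) (diamond w c) = family_at g (w ++ c).
  move=> hc; rewrite (@glueE _ _ n) ?size_diamond ?size_tuple ?hc // /B.
  by rewrite demuxE ?size_tuple // !nth_diamond size_tuple ltnn subnn ifF ?subSnn //; lia.
rewrite hf; split=> [[c hc]|[c [hc hgc]]].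
  by exists c; rewrite size_tuple; split=> //; rewrite hBc ?size_tuple // -hc family_atE.
(* Acceptance only provides some [n1] with [D n1] equal to the input length; it remains to identify
   it with [n]. *)
have /hasP[n1 _ /andP[/eqP e /and3P[h1 h2 _]]] := hgc.
rewrite size_diamond size_tuple /D in e.
have en : n1 = n.
  move: h1 h2; rewrite !nth_diamond size_tuple.
  case: (ltngtP n1 n) => // lt_n; last by have := hm _ _ (ltnW lt_n); lia.
  rewrite ltn_double lt_n ifT; last lia.
  by rewrite doubleK /= uphalf_double => ->.
subst n1; have hc' : size c == h n by apply/eqP; lia.
exists (Tuple hc'); rewrite family_atE /= -hBc //; exact/eqP.
Qed.

Lemma diamond_NP_IS f h g : polynomial_fun h -> P_IS g -> sat_by_diamond h g f ->
  NP_IS f.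
Proof.
move=> /polynomial_fun_bound [H [Hp Hm hH]] hg hf.
(* Input length plus certificate length [|u| + |v|]. *)
pose D n := n + (H n + H n + 1).
have hD : injective D.
  move=> m n; rewrite /D; case: (ltngtP m n) => // lt_mn; have := Hm _ _ (ltnW lt_mn); lia.
have hDn n : n <= D n by rewrite /D; lia.
pose V n z k := family_at g
  (mkseq (fun i => source_val z (mux_source n (H n).+1 i)) (n.*2 + k.+2)).
pose B n z := first_branch (addn n) z (V n z) (iota 0 (h n).+1).
exists (fun n => H n + H n + 1), (glue D B).
split; first exact: polynomial_funD (polynomial_funD Hp Hp) (polynomial_fun_const 1).
split; first by move=> m n /Hm; lia.
split=> [|n w].
  have [p [hp hm hX]] := P_IS_outputs hg.
  (* There are [h n + 1 <= D n] branches, each with two extra instructions, and they run sequences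
     for lengths [2n + k + 2 <= 2 * D n]. *)
  apply: (@P_IS_glue _ _ (fun N => N * (p (N + N) + 2) + 1)) => // [|n].
    apply: polynomial_funD (polynomial_fun_const 1).
    apply: polynomial_funM polynomial_fun_id _.
    apply: polynomial_funD (polynomial_fun_const 2).
    exact: polynomial_fun_comp hp (polynomial_funD polynomial_fun_id polynomial_fun_id).
  have [X {}hX] := hX (n.*2 + (h n).+3).
  have {}hX : {in iota 0 (h n).+1, forall k, let m := n.*2 + k.+2 in
      [/\ all br_instr (X m), size (X m) <= p (D n + D n) & forall z, size z = m ->
        outputs m (X m) 0 (initial_state z) (family_at g z)]}.
    move=> k; rewrite mem_iota => hk m; have [|hbr hs ho] := hX m; first by rewrite /m; lia.
    split=> //; apply: leq_trans hs (hm _ _ _).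
    by rewrite /m /D; have := hH n; lia.
  exists (branches (addn n) (fun=> mux_source n (H n).+1) (fun k => X (n.*2 + k.+2))
           (iota 0 (h n).+1)); split.
  - apply/andP; split=> //; apply: br_branches => k /hX; by case.
  - apply: leq_trans (size_branches (M := p (D n + D n)) _ _ _) _ => [k /hX|]; first by case.
    rewrite size_iota leq_add2r -addn2 leq_mul2r; apply/orP; right.
    by rewrite /D; have := hH n; lia.
  - move=> z hz.
    apply: (@outputs_branches (D n) (addn n) (fun=> mux_source n (H n).+1)
      (fun k => X (n.*2 + k.+2)) (fun k => n.*2 + k.+2) (V n z) (iota 0 (h n).+1) z [::] _ _ (frefl _)).
    move=> k hk.
    have [hbr _ ho] := hX k hk; rewrite mem_iota in hk.
    have hHn := hH n; split=> // [|i l hi|]; first by rewrite /D; lia.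
      rewrite /mux_source /D; case: ltnP => h1; first by case=> <-; lia.
      by case: eqP => // h2; case: eqP => // h3 [<-]; lia.
    by apply: ho; rewrite size_mkseq.
have hB z : size z = D n -> family_at (glue D B) z = B n z by exact: glueE.
rewrite hf; split=> [[c [hc hgc]]|[c]].
  (* One-hot code of [size c] on [H n + 1] bits, then [c] padded with F to length [H n]. *)
  pose z := mkseq (fun k => k == size c) (H n).+1 ++ c ++ nseq (H n - size c) false.
  have hz : size z == H n + H n + 1.
    by rewrite !size_cat size_mkseq size_nseq; have := hH n; lia.
  exists (Tuple hz); rewrite family_atE hB; last first.
    by rewrite size_cat size_tuple (eqP hz).
  rewrite /B (@first_branch_single _ _ _ _ (size c)); first last.
  - move=> k; rewrite mem_iota => hk.
    rewrite nth_cat size_tuple ifF ?addKn; last lia.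
    by rewrite nth_cat size_mkseq ifT ?nth_mkseq //; have := hH n; lia.
  - by rewrite mem_iota; lia.
  rewrite /V muxE ?size_mkseq ?size_tuple ?size_cat ?leq_addr //.
  by rewrite take_size_cat.
rewrite family_atE hB; last by rewrite size_cat !size_tuple.
(* The certificate is arbitrary here: [u] need not be one-hot, and the length-[k] prefix of [v] is
   the witness for an accepting [k]. *)
case/first_branch_has/hasP => k; rewrite mem_iota => hk.
rewrite /V /= -{1}(cat_take_drop (H n).+1 c) muxE ?size_tuple //; last first.
- by have := hH n; lia.
- by lia.
move=> hgc; exists (take k (drop (H n).+1 c)); split=> //.
by rewrite size_take_min; lia.
Qed.

Theorem theorem11 (f : bool_family) :
  NP_IS f <->
  exists (h : nat -> nat) (g : bool_family),
    polynomial_fun h /\ P_IS g /\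
    forall (n : nat) (w : n.-tuple bool),
      f n w = true <->
      exists c : seq bool,
        size c <= h n /\ g (size (diamond w c)) (in_tuple (diamond w c)) = true.
Proof.
split=> [/NP_IS_diamond [h [g [hp hg hf]]]|[h [g [hp [hg hf]]]]].
  by exists h, g.
exact: diamond_NP_IS hp hg hf.
Qed.
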